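(* Let $d\ge 2$. Then a Zariski generic polynomial $F\in\mathbb{C}[x,y,z,t]$ of degree at most $d$ is non-Cartesian.
   Context: A polynomial $P(x,y,z,t)\in\mathbb{C}[x,y,z,t]$ is called Cartesian if it can be written as $P(x,y,z,t)=G(x,y)F_1(x,y,z,t)+H(z,t)F_2(x,y,z,t)$, where $G\in\mathbb{C}[x,y]$ and $H\in\mathbb{C}[z,t]$ are non-constant polynomials and $F_1,F_2\in\mathbb{C}[x,y,z,t]$ are arbitrary. It is non-Cartesian if it is not Cartesian. ''A Zariski generic polynomial of degree at most $d$ has property $\mathcal{P}$'' means that there is a nonempty Zariski open (hence dense) subset of the finite-dimensional complex vector space of polynomials of degree at most $d$ in $\mathbb{C}[x,y,z,t]$, all of whose elements have property $\mathcal{P}$. *)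

(* Defs.v *)
From HB Require Import structures.
From mathcomp Require Import all_boot all_order all_algebra.
From mathcomp Require Import mpoly complex reals.

Set Implicit Arguments.
Unset Strict Implicit.
Unset Printing Implicit Defensive.

Import GRing.Theory.
Local Open Scope ring_scope.

(* The variables x, y, z, t are 'X_0, 'X_1, 'X_2, 'X_3 in {mpoly K[4]}; a
   polynomial of K[x,y] or K[z,t] is given as an element of {mpoly K[2]} and
   embedded by renaming its two variables. *)
Section Cartesian.
Variable K : comNzRingType.

Definition in_xy (G : {mpoly K[2]}) : {mpoly K[4]} :=
  G \mPo [tuple ('X_(lshift 2 i) : {mpoly K[4]}) | i < 2].

Definition in_zt (H : {mpoly K[2]}) : {mpoly K[4]} :=
  H \mPo [tuple ('X_(rshift 2 i) : {mpoly K[4]}) | i < 2].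

Definition nonconstant (n : nat) (p : {mpoly K[n]}) : Prop :=
  forall c : K, p <> c%:MP.

Definition Cartesian (P : {mpoly K[4]}) : Prop :=
  exists (G H : {mpoly K[2]}) (F1 F2 : {mpoly K[4]}),
    [/\ nonconstant G, nonconstant H & P = in_xy G * F1 + in_zt H * F2].

End Cartesian.

(* The Zariski topology on the vector space of polynomials of degree at most d
   in n variables, identified with affine space through the coefficients of
   the finitely many monomials of degree at most d. *)
Section Zariski.
Variables (K : comNzRingType) (n d : nat).

(* msize p is 1 + the total degree of p, and 0 for p = 0. *)
Definition deg_le (p : {mpoly K[n]}) : Prop := (msize p <= d.+1)%N.

Definition nb_coefs : nat := #|{: 'X_{1..n < d.+1}}|.

Definition coefs (p : {mpoly K[n]}) (i : 'I_nb_coefs) : K :=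
  p@_(bmnm (enum_val i)).

Definition zariski_closed (Z : {mpoly K[n]} -> Prop) : Prop :=
  exists S : {mpoly K[nb_coefs]} -> Prop,
    forall p, Z p <->
      deg_le p /\ (forall Q, S Q -> Q.@[coefs p] = 0).

Definition zariski_open (U : {mpoly K[n]} -> Prop) : Prop :=
  exists2 Z : {mpoly K[n]} -> Prop,
    zariski_closed Z & forall p, U p <-> deg_le p /\ ~ Z p.

Definition zariski_generic (P : {mpoly K[n]} -> Prop) : Prop :=
  exists U : {mpoly K[n]} -> Prop,
    [/\ zariski_open U, exists p, U p & forall p, U p -> P p].

End Zariski.

(* Main.v *)
Require Import Defs.
From HB Require Import structures.
From mathcomp Require Import all_boot all_order all_algebra.
From mathcomp Require Import mpoly complex reals.
From mathcomp Require Import zify ring.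

(* Write F_ij for the component of F of degree i in (x, y) and j in (z, t), and
   suppose that F = G F1 + H F2 has degree at most d.  For every p in the curve
   G = 0 the polynomial F(p, -) is divisible by H, and so is F(p, -) - F(p', -).
   Comparing homogeneous components of top degree, a point at infinity w of the
   curve H = 0 satisfies F_0d(w) = 0 and F_1,d-1(p - p', w) = 0.  Writing
   F_1,d-1 = x A + y B, the curve G = 0 is therefore contained in a line of
   direction v = (B(w), -A(w)); if q is a zero of H, then F(-, q) vanishes on
   infinitely many points of that line (if v <> 0), so that F_d0(v) = 0.  Hence
   either F_0d vanishes at (1, 0), or alpha = F_0d(s, 1) and
   beta = F_d0(B(s, 1), -A(s, 1)) have a common root.  Both events are excluded
   by the nonvanishing of the product of the coefficient of z^d in F and of the
   resultant of alpha and beta, a polynomial in the coefficients of F which is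
   nonzero at x^d + y z^(d-1) + z^d + t^d. *)

Set Implicit Arguments.
Unset Strict Implicit.
Unset Printing Implicit Defensive.

Import GRing.Theory.
Local Open Scope ring_scope.

(** * Resultants and coefficients at degree bounds *)

(** When [f] kills neither leading coefficient, both sizes are preserved, so the two Sylvester
    matrices have the same shape and correspond entrywise. *)
Lemma map_resultant_rmorph (A B : nzRingType) (f : {rmorphism A -> B})
    (p q : {poly A}) :
    f (lead_coef p) != 0 -> f (lead_coef q) != 0 ->
  f (resultant p q) = resultant (map_poly f p) (map_poly f q).
Proof.
move=> fp fq; rewrite /resultant /Sylvester_mx !size_map_poly_id0 //.
rewrite -det_map_mx map_col_mx; congr (\det (col_mx _ _));
  by apply: map_lin1_mx => v /=; rewrite map_poly_rV rmorphM /= map_rVpoly.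
Qed.

Lemma coefM_top (S : nzRingType) (p q : {poly S}) (i j : nat) :
    (size p <= i.+1)%N -> (size q <= j.+1)%N ->
  (p * q)`_(i + j) = p`_i * q`_j.
Proof.
move=> szp szq; have lti : (i < (i + j).+1)%N by rewrite ltnS leq_addr.
rewrite coefM (bigD1 (Ordinal lti)) //= addKn big1 ?addr0 // => k.
rewrite -val_eqE /= neq_ltn => /orP[ltki|ltik].
  by rewrite [q`_ _]nth_default ?mulr0 //; apply: leq_trans szq _; lia.
by rewrite [p`_ _]nth_default ?mul0r //; apply: leq_trans szp _.
Qed.

Lemma size_mul_le_top (S : nzRingType) (p q : {poly S}) (i j : nat) :
    (size p <= i.+1)%N -> (size q <= j.+1)%N ->
  (size (p * q)%R <= (i + j).+1)%N.
Proof. by move=> szp szq; apply: leq_trans (size_polyMleq _ _) _; lia. Qed.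

(** Coefficients taken at degree bounds are multiplicative even where a bound is not attained. *)
Lemma mmap1_top (S : comNzRingType) (n : nat) (h : 'I_n -> {poly S})
    (k : 'I_n -> nat) (m : 'X_{1..n}) :
    (forall i, (size (h i) <= (k i).+1)%N) ->
    let e := (\sum_i k i * m i)%N in
  (size (mmap1 h m) <= e.+1)%N /\ (mmap1 h m)`_e = mmap1 (fun i => (h i)`_(k i)) m.
Proof.
move=> szh /=; rewrite /mmap1.
elim/big_rec3: _ => [|i y e p _ [szp <-]]; first by rewrite size_poly1 coefC.
have [szi ->] : (size (h i ^+ m i)%R <= (k i * m i).+1)%N /\
    (h i)`_(k i) ^+ m i = (h i ^+ m i)`_(k i * m i).
  elim: (m i) => [|r [IHs IHc]].
    by rewrite muln0 !expr0 size_poly1 coefC.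
  rewrite mulnS !exprS coefM_top // IHc; split => //.
  exact: size_mul_le_top.
by rewrite coefM_top //; split=> //; apply: size_mul_le_top.
Qed.

Lemma rmorph_mmap1 (S T : comNzRingType) (f : {rmorphism S -> T}) (n : nat)
    (h : 'I_n -> S) (m : 'X_{1..n}) : f (mmap1 h m) = mmap1 (f \o h) m.
Proof. by rewrite rmorph_prod; apply: eq_bigr => i _; rewrite rmorphXn. Qed.

(** * Restriction to lines through the origin *)

Section Rays.
Variables (K : comNzRingType) (n : nat).

(* The restriction of [P] to the line [s |-> s w]: its coefficient of degree [e]
   is the value at [w] of the homogeneous component of degree [e] of [P]. *)
Definition ray (w : 'I_n -> K) : {mpoly K[n]} -> {poly K} :=
  mmap (@polyC K) (fun i => w i *: 'X).

HB.instance Definition _ w := GRing.RMorphism.copy (ray w)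
  (mmap (@polyC K) (fun i => w i *: 'X)).

Lemma rayX w m : ray w 'X_[m] = mmap1 w m *: 'X^(mdeg m).
Proof.
rewrite /ray mmapX /mmap1 mdegE -prodrXr -scaler_prod.
by apply: eq_bigr => i _; rewrite -exprZn.
Qed.

Lemma rayZ w c P : ray w (c *: P) = c *: ray w P.
Proof. by rewrite /ray mmapZ mul_polyC. Qed.

Lemma size_ray w P : (size (ray w P) <= msize P)%N.
Proof.
rewrite {1}(mpolyE P) raddf_sum; apply/(leq_trans (size_sum _ _ _)).
apply/bigmax_leqP_seq => m mP _ /=; rewrite rayZ rayX.
do 2![apply: leq_trans (size_scale_leq _ _) _]; rewrite size_polyXn.
exact: msize_mdeg_lt.
Qed.

End Rays.

(** Degrees add over a domain, so a drop of the degree of [H] along [w] forces the restriction of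
    [H * L] below degree [e]. *)
Lemma ray_dvd_top (K : idomainType) (n : nat) (w : 'I_n -> K)
    (H L P : {mpoly K[n]}) (e : nat) :
    (size (ray w H) < msize H)%N -> (msize P <= e.+1)%N -> P = H * L ->
  (ray w P)`_e = 0.
Proof.
move=> szH szP defP; have [L0|L0] := eqVneq L 0.
  by rewrite defP L0 mulr0 raddf0 coef0.
have H0 : H != 0 by apply: contraTneq szH => ->; rewrite msize0.
have szLH : (msize H + msize L <= e.+2)%N.
  by move: szP; rewrite defP msizeM //; lia.
apply: nth_default; rewrite defP rmorphM /=.
apply: leq_trans (size_polyMleq _ _) _.
rewrite -subn1 leq_subLR add1n -ltnS; apply: leq_trans szLH.
by rewrite -addSn leq_add // size_ray.
Qed.

(** * Zeros and points at infinity of plane curves *)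

Section Plane.
Variable K : closedFieldType.

(* The representatives (c, 1) and (1, 0) of the points of the projective line. *)
Definition chart (S : nzRingType) (c : S) (i : 'I_2) : S :=
  if i == ord0 then c else 1.
Definition pole (i : 'I_2) : K := (i == ord0)%:R.

Lemma mmap1_chart (S : comNzRingType) (c : S) (m : 'X_{1..2}) :
  mmap1 (chart c) m = c ^+ m ord0.
Proof. by rewrite /mmap1 !big_ord_recl big_ord0 /chart /= expr1n !mulr1. Qed.

Lemma mmap1_pole (m : 'X_{1..2}) : mmap1 pole m = (m ord0 == mdeg m)%:R.
Proof.
rewrite /mmap1 mdegE !big_ord_recl !big_ord0 /pole /= expr1n mul1r mulr1 expr0n.
by congr (_%:R); lia.
Qed.

(** If the variable [i] occurs in [G], then for all but finitely many values [a] of the other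
    variable [j], [G] remains nonconstant in [i] and has a zero there. Hence the curve takes
    infinitely many values of the coordinate [j]. *)
Lemma exists_zero_avoiding (G : {mpoly K[2]}) : nonconstant G ->
  exists j : 'I_2, forall l : {poly K}, l != 0 ->
  exists2 p : 'I_2 -> K, G.@[p] = 0 & l.[p j] != 0.
Proof.
move=> Gnc.
have [m mG [i mi]] : exists2 m, m \in msupp G & exists i, m i != 0%N.
  have [/hasP[m mG mn0]|/hasPn G0] := boolP (has (fun m => m != 0%MM) (msupp G)).
    exists m => //; apply/existsP; apply: contraNT mn0.
    rewrite negb_exists => /forallP m0; apply/eqP/mnmP => i.
    by have := m0 i; rewrite negbK mnm0E => /eqP.
  case: (Gnc G@_0%MM); apply/mpolyP => m; rewrite mcoeffC.
  have [<-|mn0] := eqVneq 0%MM m; first by rewrite mulr1.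
  rewrite mulr0; apply: memN_msupp_eq0; apply: contra_neqN mn0 => /G0.
  by rewrite negbK => /eqP.
pose j := rev_ord i.
have ijP k : (k == i) || (k == j) by case: k i @j {mi} => [[|[]]// ?] [[|[]]// ?].
have nij : i != j by case: i @j {mi ijP} => [[|[]]// ?].
exists j => l l0.
(* This is the coefficient of the power [m i] of the variable [i] in [G], as a polynomial in the
   variable [j]. *)
pose c : {poly K} := \sum_(u <- msupp G | u i == m i) G@_u *: 'X^(u j).
have cm : c != 0.
  apply/eqP => /(congr1 (coefp (m j))); rewrite /coefp coef0 coef_sum.
  rewrite big_mkcond (bigD1_seq m) ?msupp_uniq //= eqxx coefZ coefXn eqxx mulr1.
  rewrite big1 ?addr0 => [|u um]; first by apply/eqP; rewrite mcoeff_msupp in mG.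
  case: eqP => // ui; rewrite coefZ coefXn; case: eqP => [uj|_]; last exact: mulr0.
  case/eqP: um; apply/mnmP => k.
  by case/orP: (ijP k) => /eqP ->; [|apply/esym].
have /closed_nonrootP[a] : l * c != 0 by rewrite mulf_neq0.
rewrite rootM negb_or => /andP[la ca].
pose q : {poly K} := mmap (@polyC K) (fun k => if k == i then 'X else a%:P) G.
have qE : q = \sum_(u <- msupp G) (G@_u * a ^+ u j) *: 'X^(u i).
  apply: eq_bigr => u _; rewrite /mmap1 (bigD1 i) //= (bigD1 j) 1?eq_sym //= big1.
    by rewrite eqxx (negPf nij) mulr1 mul_polyC mulrC -rmorphXn /=
      mul_polyC scalerA.
  by move=> k /andP[k1 k2]; move: (ijP k); rewrite (negPf k1) (negPf k2).
(* This coefficient is [c.[a]]; as [m i] is positive, [q] is not constant. *)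
have qm : q`_(m i) != 0.
  apply: contraNneq ca => q0; apply/rootP; rewrite -q0 qE coef_sum horner_sum.
  rewrite big_mkcond; apply: eq_bigr => u _; rewrite coefZ coefXn eq_sym.
  by case: eqP => _; rewrite ?mulr1 ?mulr0 // hornerZ hornerXn.
have /closed_rootP[b qb] : size q != 1.
  apply: contra_neqN qm => q1; rewrite nth_default // (eqP q1).
  by rewrite lt0n.
exists (fun k => if k == i then b else a); last
  by rewrite [j == i]eq_sym (negPf nij).
rewrite -(rootP qb) mevalE horner_sum; apply: eq_bigr => u _.
rewrite hornerM hornerC horner_prod; congr (_ * _); apply: eq_bigr => k _.
by rewrite horner_exp; case: eqP; rewrite ?hornerX ?hornerC.
Qed.

Lemma exists_point_at_infinity (H : {mpoly K[2]}) : nonconstant H ->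
  (exists c, (size (ray (chart c) H) < msize H)%N) \/
  (size (ray pole H) < msize H)%N.
Proof.
move=> Hnc; have szH : (1 < msize H)%N.
  rewrite ltnNge; apply/negP => szH; case: (Hnc H@_0%MM).
  by apply: msize1_polyC.
set k := (msize H).-1; have kE : msize H = k.+1 by rewrite /k; lia.
have k0 : (0 < k)%N by lia.
have rayE w : (ray w H)`_k = \sum_(m <- msupp H | mdeg m == k) H@_m * mmap1 w m.
  rewrite {1}(mpolyE H) raddf_sum coef_sum [RHS]big_mkcond /=.
  apply: eq_bigr => m _; rewrite rayZ rayX !coefZ coefXn eq_sym.
  by case: eqP; rewrite ?mulr1 // !mulr0.
have lt_top w : (ray w H)`_k = 0 -> (size (ray w H) < msize H)%N.
  move=> top; rewrite kE ltnS; apply/leq_sizeP => j; rewrite leq_eqVlt.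
  case/orP => [/eqP <- //|ltkj]; apply: nth_default.
  by apply: leq_trans (size_ray _ _) _; rewrite kE.
(* The top form of [H], dehomogenised. If it has no root, it is a nonzero constant; its coefficient
   of degree [k > 0], the value of the top form at [pole], is then zero. *)
pose eta : {poly K} := \sum_(m <- msupp H | mdeg m == k) H@_m *: 'X^(m ord0).
have [/closed_rootP[c /rootP eta_c]|] := boolP (size eta != 1).
  left; exists c; apply: lt_top; rewrite rayE.
  transitivity eta.[c] => //; rewrite horner_sum.
  by apply: eq_bigr => m _; rewrite mmap1_chart hornerZ hornerXn.
rewrite negbK => /eqP eta1; right; apply: lt_top.
transitivity eta`_k; last by rewrite nth_default ?eta1.
rewrite rayE coef_sum; apply: eq_bigr => m /eqP mk.
by rewrite mmap1_pole coefZ coefXn mk eq_sym.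
Qed.

End Plane.

(** * Separating the variables (x, y) from (z, t) *)

Lemma mmap_comp_mpoly (R S : comNzRingType) (f : {rmorphism R -> S}) (n k : nat)
    (h : 'I_k -> S) (lq : n.-tuple {mpoly R[k]}) (p : {mpoly R[n]}) :
  mmap f h (p \mPo lq) = mmap f (fun i => mmap f h (tnth lq i)) p.
Proof.
rewrite [X in mmap f h X = _]comp_mpolyE raddf_sum; apply: eq_bigr => m _ /=.
rewrite mmapZ rmorph_prod; congr (_ * _).
by apply: eq_bigr => i _; rewrite rmorphXn.
Qed.

Section Split.

Definition mxy (m : 'X_{1..4}) : 'X_{1..2} := [multinom m (lshift 2 i) | i < 2].
Definition mzt (m : 'X_{1..4}) : 'X_{1..2} := [multinom m (rshift 2 i) | i < 2].

Lemma mdeg_split (m : 'X_{1..4}) : mdeg m = (mdeg (mxy m) + mdeg (mzt m))%N.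
Proof.
rewrite !mdegE (@big_split_ord _ _ _ 2 2) /=.
by congr (_ + _)%N; apply: eq_bigr => i _; rewrite mnmE.
Qed.

Definition point (S : Type) (p q : 'I_2 -> S) (i : 'I_4) : S :=
  match split (i : 'I_(2 + 2)) with inl j => p j | inr j => q j end.

Lemma pointl (S : Type) (p q : 'I_2 -> S) (i : 'I_2) : point p q (lshift 2 i) = p i.
Proof. by rewrite /point (unsplitK (inl i)). Qed.

Lemma pointr (S : Type) (p q : 'I_2 -> S) (i : 'I_2) : point p q (rshift 2 i) = q i.
Proof. by rewrite /point (unsplitK (inr i)). Qed.

Lemma mmap1_point (S : comNzRingType) (p q : 'I_2 -> S) m :
  mmap1 (point p q) m = mmap1 p (mxy m) * mmap1 q (mzt m).
Proof.
rewrite /mmap1 (@big_split_ord _ _ _ 2 2) /=.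
by congr (_ * _); apply: eq_bigr => i _; rewrite ?pointl ?pointr mnmE.
Qed.

Variables (R S : comNzRingType) (f : {rmorphism R -> S}) (p q : 'I_2 -> S).

Lemma mmap_in_xy G : mmap f (point p q) (in_xy G) = mmap f p G.
Proof.
rewrite mmap_comp_mpoly; apply: eq_bigr => m _; congr (_ * _).
apply: eq_bigr => i _; congr (_ ^+ _).
by rewrite tnth_mktuple mmapX mmap1U pointl.
Qed.

Lemma mmap_in_zt H : mmap f (point p q) (in_zt H) = mmap f q H.
Proof.
rewrite mmap_comp_mpoly; apply: eq_bigr => m _; congr (_ * _).
apply: eq_bigr => i _; congr (_ ^+ _).
by rewrite tnth_mktuple mmapX mmap1U pointr.
Qed.

End Split.

(** * The bihomogeneous components used in the elimination *)

Section Forms.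
Variables (S : comNzRingType) (d : nat).
Implicit Type a : 'X_{1..4 < d.+1} -> S.

(** The coefficient family lives in an arbitrary ring, so that it can be either that of an actual
    polynomial or a family of indeterminates. *)
Definition slice (P : pred 'X_{1..4}) (g : 'X_{1..4} -> {poly S}) a : {poly S} :=
  \sum_(m : 'X_{1..4 < d.+1} | P m) a m *: g m.

(* The polynomials F_0d(s, 1), A(s, 1), B(s, 1), (B(s, 1), -A(s, 1)) and
   F_d0(B(s, 1), -A(s, 1)), where [a] lists the coefficients of F. *)
Definition alpha a :=
  slice (fun m => mdeg (mzt m) == d) (fun m => 'X^(mzt m ord0)) a.

Definition pencil (i : 'I_2) a :=
  slice (fun m => (mxy m == U_(i)%MM) && (mdeg (mzt m) == d.-1))
        (fun m => 'X^(mzt m ord0)) a.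

Definition direction a (i : 'I_2) : {poly S} :=
  if i == ord0 then pencil ord_max a else - pencil ord0 a.

Definition beta a :=
  slice (fun m => mdeg (mxy m) == d) (fun m => mmap1 (direction a) (mxy m)) a.

End Forms.

(** * The algebraic condition satisfied by Cartesian polynomials *)

Section CartesianRoot.
Variables (K : closedFieldType) (d : nat) (F : {mpoly K[4]}).
Hypothesis szF : (msize F <= d.+1)%N.

Let a (m : 'X_{1..4 < d.+1}) : K := F@_m.

(* The polynomial F(p, -) in the last two variables. *)
Definition spec (p : 'I_2 -> K) : {mpoly K[4]} -> {mpoly K[2]} :=
  mmap (@mpolyC 2 K) (point (fun i => (p i)%:MP) (fun j => 'X_j)).

Lemma specE p :
  spec p F = \sum_(m : 'X_{1..4 < d.+1}) (a m * mmap1 p (mxy m)) *: 'X_[mzt m].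
Proof.
rewrite /spec (mmapE _ szF); apply: eq_bigr => m _.
rewrite mmap1_point -(rmorph_mmap1 (@mpolyC 2 K)) mulrA -rmorphM mul_mpolyC /=.
by rewrite [in RHS]mpolyXE_id.
Qed.

Lemma mdeg_bound (m : 'X_{1..4 < d.+1}) : (mdeg (mxy m) + mdeg (mzt m) <= d)%N.
Proof. by rewrite -mdeg_split -ltnS bmdeg. Qed.

Lemma msize_spec_sum (c : 'X_{1..4 < d.+1} -> K) e :
    (forall m : 'X_{1..4 < d.+1}, c m != 0 -> (mdeg (mzt m) <= e)%N) ->
  (msize (\sum_(m : 'X_{1..4 < d.+1}) c m *: 'X_[K, mzt m]) <= e.+1)%N.
Proof.
move=> ce; apply: leq_trans (msize_sum _ _ _) _; apply/bigmax_leqP => m _.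
have [->|/ce le_e] := eqVneq (c m) 0; first by rewrite scale0r msize0.
by apply: leq_trans (msizeZ_le _ _) _; rewrite msizeX.
Qed.

Lemma msize_spec p : (msize (spec p F) <= d.+1)%N.
Proof.
rewrite specE; apply: msize_spec_sum => m _.
by apply: leq_trans (mdeg_bound m); rewrite leq_addl.
Qed.

(** Monomials of degree [d] in (z, t) contain neither x nor y, so their coefficients do not depend
    on the point and cancel. *)
Lemma msize_specB p p' : (0 < d)%N -> (msize (spec p F - spec p' F) <= d.-1.+1)%N.
Proof.
move=> d0; rewrite !specE -sumrB; under eq_bigr do rewrite -scalerBl -mulrBr.
apply: msize_spec_sum => m; rewrite -ltnS prednK // ltnNge; apply: contraNN => led.
have /eqP : mdeg (mxy m) = 0%N by have := mdeg_bound m; lia.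
by rewrite mdeg_eq0 => /eqP ->; rewrite !mmap11 subrr mulr0.
Qed.

Lemma coef_ray_spec w p j : (ray w (spec p F))`_j =
  \sum_(m : 'X_{1..4 < d.+1} | mdeg (mzt m) == j)
    a m * mmap1 p (mxy m) * mmap1 w (mzt m).
Proof.
rewrite specE raddf_sum coef_sum [RHS]big_mkcond; apply: eq_bigr => m _ /=.
rewrite rayZ rayX !coefZ coefXn eq_sym.
by case: eqP; rewrite ?mulr1 // !mulr0.
Qed.

Lemma coef_ray_spec_top w p : (ray w (spec p F))`_d =
  \sum_(m : 'X_{1..4 < d.+1} | mdeg (mzt m) == d) a m * mmap1 w (mzt m).
Proof.
rewrite coef_ray_spec; apply: eq_bigr => m /eqP md.
have /eqP : mdeg (mxy m) = 0%N by have := mdeg_bound m; lia.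
by rewrite mdeg_eq0 => /eqP ->; rewrite mmap11 mulr1.
Qed.

Lemma coef_ray_spec_pole p : (ray (@pole K) (spec p F))`_d = (alpha a)`_d.
Proof.
rewrite coef_ray_spec_top coef_sum; apply: eq_bigr => m /eqP md.
by rewrite mmap1_pole coefZ coefXn md eq_sym.
Qed.

Lemma coef_ray_spec_chart c p : (ray (chart c) (spec p F))`_d = (alpha a).[c].
Proof.
rewrite coef_ray_spec_top horner_sum; apply: eq_bigr => m _.
by rewrite mmap1_chart hornerZ hornerXn.
Qed.

(** Only the components F_0,d-1 and F_1,d-1 contribute: the first cancels in the difference and the
    second is linear in (x, y). *)
Lemma coef_ray_specB_chart c p p' : (0 < d)%N ->
  (ray (chart c) (spec p F - spec p' F))`_d.-1 =
  \sum_i (p i - p' i) * (pencil i a).[c].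
Proof.
move=> d0; rewrite raddfB coefB !coef_ray_spec -sumrB.
under [RHS]eq_bigr => i _.
  rewrite horner_sum mulr_sumr (big_mkcond (fun m : 'X_{1..4 < d.+1} => _ && _)).
  over.
rewrite exchange_big [LHS]big_mkcond; apply: eq_bigr => m _ /=.
case: eqP => md; last by rewrite big1 // => i _; rewrite andbF.
rewrite -mulrBl -mulrBr; under eq_bigr do rewrite andbT.
have [x0|x0] := eqVneq (mdeg (mxy m)) 0%N.
  move/eqP: x0; rewrite mdeg_eq0 => /eqP x0; rewrite x0 !mmap11 subrr mulr0 mul0r.
  rewrite big1 // => i _; case: eqP => // /(congr1 mdeg).
  by rewrite mdeg0 mdeg1.
have /eqP : mdeg (mxy m) = 1%N by have := mdeg_bound m; lia.
case/mdeg1P => k /eqP xk; rewrite xk (bigD1 k) //= eqxx big1 ?addr0 => [|i nik].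
  by rewrite !mmap1U hornerZ hornerXn mmap1_chart; ring.
case: eqP => // /(congr1 (fun u : 'X_{1..2} => u i)).
by rewrite !mnm1E eqxx eq_sym (negPf nik).
Qed.

(** The coefficient of degree [d] along the line is F_d0(v), whatever the base point [p] and the
    value [q] of (z, t). *)
Lemma coef_line p q (v : 'I_2 -> K) :
  (mmap (@polyC K)
     (point (fun i => (p i)%:P + v i *: 'X) (fun j => (q j)%:P)) F)`_d =
  \sum_(m : 'X_{1..4 < d.+1} | mdeg (mxy m) == d) a m * mmap1 v (mxy m).
Proof.
rewrite (mmapE _ szF) coef_sum [RHS]big_mkcond; apply: eq_bigr => m _.
rewrite mmap1_point coefCM.
have sz1 i : (size ((p i)%:P + v i *: 'X)%R <= 2)%N.
  apply: leq_trans (size_polyD _ _) _; rewrite geq_max size_polyC.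
  by rewrite (leq_trans (size_scale_leq _ _)) ?size_polyX // (leq_trans (leq_b1 _)).
have [szm coefm] := mmap1_top (mxy m) sz1.
rewrite -(rmorph_mmap1 (@polyC K)) coefMC.
have sumE : (\sum_i 1 * mxy m i)%N = mdeg (mxy m).
  by rewrite mdegE; under eq_bigr do rewrite mul1n.
rewrite sumE in szm coefm; case: eqP => md; last first.
  rewrite nth_default ?mul0r ?mulr0 //; apply: leq_trans szm _.
  by have := mdeg_bound m; lia.
have /eqP : mdeg (mzt m) = 0%N by have := mdeg_bound m; lia.
rewrite mdeg_eq0 => /eqP ->; rewrite mmap11 mulr1.
rewrite md in coefm; rewrite coefm; congr (_ * _).
apply: eq_bigr => i _; congr (_ ^+ _).
by rewrite coefD coefC coefZ coefX mulr1 add0r.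
Qed.

Lemma cartesian_common_root : (0 < d)%N -> Cartesian F ->
  (alpha a)`_d = 0 \/ exists2 c, (alpha a).[c] = 0 & (beta a).[c] = 0.
Proof.
move=> d0 [G [H [F1 [F2 [Gnc Hnc defF]]]]].
have specF p : G.@[p] = 0 -> spec p F = H * spec p F2.
  move=> Gp; rewrite defF /spec rmorphD !rmorphM /= mmap_in_xy mmap_in_zt.
  have -> : mmap (@mpolyC 2 K) (fun i => (p i)%:MP) G = G.@[p]%:MP.
    rewrite mevalE rmorph_sum; apply: eq_bigr => m _.
    rewrite rmorphM rmorph_prod; congr (_ * _).
    by apply: eq_bigr => i _; rewrite rmorphXn.
  rewrite Gp mpolyC0 mul0r add0r; congr (_ * _).
  rewrite [RHS]mpolyE; apply: eq_bigr => m _.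
  by rewrite mul_mpolyC [in RHS]mpolyXE_id.
have Fpq p q : G.@[p] = 0 -> H.@[q] = 0 -> F.@[point p q] = 0.
  move=> Gp Hq; rewrite defF /meval rmorphD !rmorphM /=.
  rewrite (mmap_in_xy idfun) (mmap_in_zt idfun).
  by move: Gp Hq; rewrite /meval => -> ->; rewrite !mul0r addr0.
have [j avoid] := exists_zero_avoiding Gnc.
have [p0 Gp0 _] := avoid 1 (oner_neq0 _).
have [_ /(_ 1 (oner_neq0 _))[q Hq _]] := exists_zero_avoiding Hnc.
case: (exists_point_at_infinity Hnc) => [[c Hc]|Hpole]; last first.
  by left; rewrite -(coef_ray_spec_pole p0);
    apply: ray_dvd_top Hpole (msize_spec _) (specF _ Gp0).
right; exists c.
  by rewrite -(coef_ray_spec_chart c p0);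
    apply: ray_dvd_top Hc (msize_spec _) (specF _ Gp0).
have linear_rel p : G.@[p] = 0 -> \sum_i (p i - p0 i) * (pencil i a).[c] = 0.
  move=> Gp; rewrite -coef_ray_specB_chart //.
  apply: ray_dvd_top Hc (msize_specB _ _ d0) _.
  by rewrite specF // [spec p0 F]specF // -mulrBr.
pose v i := (direction a i).[c].
have -> : (beta a).[c] =
    \sum_(m : 'X_{1..4 < d.+1} | mdeg (mxy m) == d) a m * mmap1 v (mxy m).
  rewrite horner_sum; apply: eq_bigr => m _; rewrite hornerZ horner_prod.
  by congr (_ * _); apply: eq_bigr => i _; rewrite horner_exp.
rewrite -(coef_line p0 q); set f := mmap _ _ F.
have fE s : f.[s] = F.@[point (fun i => p0 i + s * v i) q].
  rewrite mevalE horner_sum; apply: eq_bigr => m _.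
  rewrite hornerM hornerC horner_prod; congr (_ * _); apply: eq_bigr => i _.
  rewrite horner_exp /point; congr (_ ^+ _); case: (split _) => k.
    by rewrite hornerD hornerZ hornerX hornerC mulrC.
  by rewrite hornerC.
(* If [f] were nonzero, its finitely many roots would give finitely many values of the coordinate
   [j] on the line. Some zero [p] of [G] avoids them all, yet [p] lies on the line and its parameter
   is a root of [f]. *)
suff -> : f = 0 by rewrite coef0.
apply/eqP/negPn/negP => f0.
have [r defr] := closed_field_poly_normal f.
have [|p Gp] := avoid (\prod_(z <- [seq p0 j + s * v j | s <- r]) ('X - z%:P)).
  exact/monic_neq0/monic_prod_XsubC.
case/negP; rewrite -/(root _ _) root_prod_XsubC.
have [s ps] : exists s, forall i, p i = p0 i + s * v i.
  set A := fun i => (pencil i a).[c].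
  have rel : (p ord0 - p0 ord0) * A ord0 + (p ord_max - p0 ord_max) * A ord_max = 0.
    rewrite -(linear_rel p Gp) !big_ord_recl big_ord0 addr0.
    by have -> : lift ord0 ord0 = ord_max :> 'I_2 by apply: val_inj.
  have v0 : v ord0 = A ord_max by [].
  have v1 : v ord_max = - A ord0 by rewrite /v /direction /= hornerN.
  have ord2P (P : 'I_2 -> Prop) : P ord0 -> P ord_max -> forall i, P i.
    move=> P0 P1 i; have [->//|->//] : i = ord0 \/ i = ord_max.
    by case: i => [[|[|//]] ?]; [left|right]; apply: val_inj.
  (* By [rel], [p - p0] is proportional to [v] as soon as [v] is nonzero; the parameter is read off
     a nonzero coordinate of [v]. *)
  have [A1|A1] := eqVneq (A ord_max) 0; last first.
    exists ((p ord0 - p0 ord0) / A ord_max); apply: ord2P; rewrite ?v0 ?v1.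
      by field.
    apply: (mulIf A1); apply/eqP; rewrite -subr_eq0; apply/eqP.
    by rewrite -[RHS]rel; field.
  have [A0|A0] := eqVneq (A ord0) 0.
    (* Here [v = 0], so [f] takes everywhere the value of [F] at [(p0, q)], which is zero: a
       contradiction. *)
    have /closed_nonrootP[x] := f0.
    rewrite rootE fE (meval_eq _ (v2 := point p0 q)).
      by rewrite Fpq ?eqxx.
    move=> i; rewrite /point; case: (split _) => // k.
    by move: k; apply: ord2P; rewrite ?v0 ?v1 ?A1 ?A0 ?oppr0 mulr0 addr0.
  exists ((p0 ord_max - p ord_max) / A ord0); apply: ord2P; rewrite ?v0 ?v1.
    rewrite A1 mulr0 addr0; apply/eqP; rewrite -subr_eq0 -(mulIr_eq0 _ (mulIf A0)).
    by move: rel; rewrite A1 mulr0 addr0 => ->.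
  by field.
rewrite ps; apply: map_f; rewrite -root_prod_XsubC.
have : root f s by rewrite rootE fE -(Fpq p q Gp Hq); apply/eqP/meval_eq => i;
  rewrite /point; case: (split _) => // k; rewrite ps.
by rewrite {1}defr rootZ // lead_coef_eq0.
Qed.

End CartesianRoot.

(** * Base change, degree bounds and values at the witness *)

Section FormsTheory.
Variable d : nat.

Lemma map_slice (S T : comNzRingType) (f : {rmorphism S -> T})
    (P : pred 'X_{1..4}) (g : 'X_{1..4} -> {poly S}) (a : 'X_{1..4 < d.+1} -> S) :
  map_poly f (slice P g a) = slice P (map_poly f \o g) (f \o a).
Proof. by rewrite /slice rmorph_sum; apply: eq_bigr => m _; rewrite /= map_polyZ. Qed.

Lemma eq_slice (S : comNzRingType) (P : pred 'X_{1..4})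
    (g h : 'X_{1..4} -> {poly S}) (a b : 'X_{1..4 < d.+1} -> S) :
  g =1 h -> a =1 b -> slice P g a = slice P h b.
Proof. by move=> gh ab; apply: eq_bigr => m _; rewrite gh ab. Qed.

Lemma map_alpha (S T : comNzRingType) (f : {rmorphism S -> T})
    (a : 'X_{1..4 < d.+1} -> S) :
  map_poly f (alpha a) = alpha (f \o a).
Proof. by rewrite map_slice; apply: eq_slice => // m; rewrite /= map_polyXn. Qed.

Lemma map_pencil (S T : comNzRingType) (f : {rmorphism S -> T}) i
    (a : 'X_{1..4 < d.+1} -> S) :
  map_poly f (pencil i a) = pencil i (f \o a).
Proof. by rewrite map_slice; apply: eq_slice => // m; rewrite /= map_polyXn. Qed.

Lemma map_direction (S T : comNzRingType) (f : {rmorphism S -> T})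
    (a : 'X_{1..4 < d.+1} -> S) i :
  map_poly f (direction a i) = direction (f \o a) i.
Proof. by rewrite /direction; case: eqP => _; rewrite ?rmorphN /= map_pencil. Qed.

Lemma map_beta (S T : comNzRingType) (f : {rmorphism S -> T})
    (a : 'X_{1..4 < d.+1} -> S) :
  map_poly f (beta a) = beta (f \o a).
Proof.
rewrite map_slice; apply: eq_slice => // m /=.
by rewrite rmorph_mmap1; apply: eq_bigr => i _; rewrite /= map_direction.
Qed.

Lemma size_slice (S : comNzRingType) (P : pred 'X_{1..4})
    (g : 'X_{1..4} -> {poly S}) (a : 'X_{1..4 < d.+1} -> S) e :
  (forall m, P m -> (size (g m) <= e)%N) -> (size (slice P g a) <= e)%N.
Proof.
move=> ge; apply: leq_trans (size_sum _ _ _) _; apply/bigmax_leqP => m Pm.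
by apply: leq_trans (size_scale_leq _ _) _; apply: ge.
Qed.

Lemma mnm_le_mdeg n (m : 'X_{1..n}) i : (m i <= mdeg m)%N.
Proof. by rewrite mdegE (bigD1 i) //= leq_addr. Qed.

Lemma size_alpha (S : comNzRingType) (a : 'X_{1..4 < d.+1} -> S) :
  (size (alpha a) <= d.+1)%N.
Proof. by apply: size_slice => m /eqP <-; rewrite size_polyXn ltnS mnm_le_mdeg. Qed.

Lemma size_pencil (S : comNzRingType) i (a : 'X_{1..4 < d.+1} -> S) :
  (size (pencil i a) <= d.-1.+1)%N.
Proof.
by apply: size_slice => m /andP[_ /eqP <-]; rewrite size_polyXn ltnS mnm_le_mdeg.
Qed.

(** Polynomials of degree at most [d.-1] are substituted into monomials of degree [d]. *)
Lemma size_beta (S : comNzRingType) (a : 'X_{1..4 < d.+1} -> S) :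
  (size (beta a) <= (d.-1 * d).+1)%N.
Proof.
apply: size_slice => m /eqP md.
have szd i : (size (direction a i) <= d.-1.+1)%N.
  by rewrite /direction; case: eqP => _; rewrite ?size_polyN size_pencil.
by have [] := mmap1_top (mxy m) szd; rewrite -big_distrr /= -mdegE md.
Qed.

Section Coefficients.
Variable K : comNzRingType.

Definition coef_fun (p : {mpoly K[4]}) (m : 'X_{1..4 < d.+1}) : K := p@_m.

Lemma sliceD P (g : 'X_{1..4} -> {poly K}) p q :
  slice P g (coef_fun (p + q)) = slice P g (coef_fun p) + slice P g (coef_fun q).
Proof.
by rewrite -big_split; apply: eq_bigr => m _; rewrite /coef_fun mcoeffD scalerDl.
Qed.

Lemma sliceX P (g : 'X_{1..4} -> {poly K}) u : (mdeg u <= d)%N ->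
  slice P g (coef_fun 'X_[u]) = if P u then g u else 0.
Proof.
rewrite -ltnS => ud; rewrite /slice big_mkcond (bigD1 (BMultinom ud)) //= big1.
  by rewrite addr0 /coef_fun mcoeffX eqxx scale1r.
move=> m mu; case: ifP => // _; rewrite /coef_fun mcoeffX.
case: eqP => [um|_]; last by rewrite scale0r.
by case/eqP: mu; apply/val_inj.
Qed.

Definition join (u v : 'X_{1..2}) : 'X_{1..4} := [multinom point u v i | i < 4].

Lemma mxy_join u v : mxy (join u v) = u.
Proof. by apply/mnmP => i; rewrite !mnmE pointl. Qed.

Lemma mzt_join u v : mzt (join u v) = v.
Proof. by apply/mnmP => i; rewrite !mnmE pointr. Qed.

Lemma mdeg_join u v : mdeg (join u v) = (mdeg u + mdeg v)%N.
Proof. by rewrite mdeg_split mxy_join mzt_join. Qed.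

(* [x^d + y z^(d-1) + z^d + t^d] *)
Definition witness : {mpoly K[4]} :=
  'X_[join (U_(ord0) *+ d) 0] + 'X_[join U_(ord_max) (U_(ord0) *+ d.-1)] +
  ('X_[join 0 (U_(ord0) *+ d)] + 'X_[join 0 (U_(ord_max) *+ d)]).

Hypothesis d2 : (2 <= d)%N.

Lemma witness_deg : deg_le d witness.
Proof.
have degD (p q : {mpoly K[4]}) : deg_le d p -> deg_le d q -> deg_le d (p + q).
  by move=> pd qd; apply: leq_trans (msizeD_le _ _) _; rewrite geq_max pd.
by do 2!apply: (degD); rewrite /deg_le msizeX mdeg_join ?mdegMn ?mdeg1 ?mdeg0; lia.
Qed.

Lemma slice_witness P (g : 'X_{1..4} -> {poly K})
    (h := fun u => if P u then g u else 0) :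
  slice P g (coef_fun witness) =
  h (join (U_(ord0) *+ d) 0) + h (join U_(ord_max) (U_(ord0) *+ d.-1)) +
  (h (join 0 (U_(ord0) *+ d)) + h (join 0 (U_(ord_max) *+ d))).
Proof.
by rewrite !sliceD !sliceX // mdeg_join ?mdegMn ?mdeg1 ?mdeg0; lia.
Qed.

Lemma alpha_witness : alpha (coef_fun witness) = 'X^d + 1.
Proof.
rewrite /alpha slice_witness !mzt_join !mdegMn !mdeg1 mdeg0 !mul1n eqxx.
have -> : (0 == d)%N = false by lia.
have -> : (d.-1 == d)%N = false by lia.
by rewrite !add0r !mulmnE !mnm1E /= mul1n mul0n.
Qed.

(** Only x^d has degree [d] in (x, y), so [beta] is the [d]-th power of the first entry of
    [direction], to which y z^(d-1) contributes the power [d.-1] of the variable. *)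
Lemma beta_witness : beta (coef_fun witness) = 'X^(d.-1 * d).
Proof.
rewrite /beta slice_witness !mxy_join !mdegMn !mdeg1 mdeg0 !mul1n eqxx.
have -> : (0 == d)%N = false by lia.
have -> : (1 == d)%N = false by lia.
rewrite !addr0 /mmap1 big_ord_recl big_ord1 !mulmnE !mnm1E /= expr0 mulr1 mul1n.
rewrite /direction eqxx /pencil slice_witness !mxy_join !mzt_join.
rewrite !mdegMn !mdeg1 mdeg0 !mul1n !eqxx /=.
have -> : (d == d.-1)%N = false by lia.
have -> : (0 == d.-1)%N = false by lia.
by rewrite !andbF !addr0 add0r mulmnE mnm1E /= mul1n exprM.
Qed.

End Coefficients.
End FormsTheory.

(** * The polynomial in the coefficients that vanishes on Cartesian polynomials *)

Section Resultant.
Variables (K : closedFieldType) (d : nat).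
Hypothesis d2 : (2 <= d)%N.

Let N := nb_coefs 4 d.
Let gen (m : 'X_{1..4 < d.+1}) : {mpoly K[N]} := 'X_(enum_rank m).

Lemma meval_gen (p : {mpoly K[4]}) :
  meval (@coefs K 4 d p) \o gen =1 @coef_fun d K p.
Proof. by move=> m; rewrite /= mevalXU /coefs enum_rankK. Qed.

Definition discr : {mpoly K[N]} := resultant (alpha gen) (beta gen) * (alpha gen)`_d.

Let ev (p : {mpoly K[4]}) : {rmorphism {mpoly K[N]} -> K} := meval (@coefs K 4 d p).

Lemma ev_alpha p : map_poly (ev p) (alpha gen) = alpha (@coef_fun d K p).
Proof. by rewrite map_alpha; apply: eq_slice => //; apply: meval_gen. Qed.

Lemma ev_beta p : map_poly (ev p) (beta gen) = beta (@coef_fun d K p).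
Proof.
rewrite map_beta; apply: eq_slice => [m|]; last exact: meval_gen.
apply: eq_bigr => i _; congr (_ ^+ _).
by rewrite /direction; case: eqP => _; [|congr (- _)];
  apply: eq_slice => //; apply: meval_gen.
Qed.

Lemma alpha_lead : ev (witness d K) (alpha gen)`_d = 1.
Proof.
rewrite -coef_map ev_alpha alpha_witness // coefD coefXn eqxx coef1.
by rewrite gtn_eqF ?addr0 //; lia.
Qed.

Lemma beta_lead : ev (witness d K) (beta gen)`_(d.-1 * d) = 1.
Proof. by rewrite -coef_map ev_beta beta_witness // coefXn eqxx. Qed.

(** The degree bound is attained generically because it is attained at the witness. *)
Lemma size_alpha_gen : size (alpha gen) = d.+1.
Proof.
apply/eqP; rewrite eqn_leq size_alpha ltnNge /=; apply/negP => sz.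
by have /eqP := alpha_lead; rewrite nth_default // rmorph0 eq_sym oner_eq0.
Qed.

Lemma size_beta_gen : size (beta gen) = (d.-1 * d).+1.
Proof.
apply/eqP; rewrite eqn_leq size_beta ltnNge /=; apply/negP => sz.
by have /eqP := beta_lead; rewrite nth_default // rmorph0 eq_sym oner_eq0.
Qed.

(** Both leading coefficients survive at the witness, so evaluation commutes with the resultant. The
    two specialised polynomials are coprime, 0 not being a root of ['X^d + 1]. *)
Lemma discr_witness : discr.@[@coefs K 4 d (witness d K)] != 0.
Proof.
rewrite -/(ev _ _) rmorphM /= -/(ev _ _) alpha_lead mulr1.
rewrite -/(ev _ _) map_resultant_rmorph; first last.
- by rewrite lead_coefE size_beta_gen beta_lead oner_neq0.
- by rewrite lead_coefE size_alpha_gen alpha_lead oner_neq0.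
rewrite ev_alpha ev_beta alpha_witness // beta_witness // resultant_eq0.
have : coprimep ('X^d + 1 : {poly K}) 'X^(d.-1 * d).
  apply: coprimep_expr; rewrite coprimepX rootE !hornerE.
  by rewrite expr0n gtn_eqF ?add0r ?oner_neq0 //; lia.
by rewrite /coprimep => /eqP ->.
Qed.

Lemma discr_cartesian (p : {mpoly K[4]}) :
  deg_le d p -> Cartesian p -> discr.@[@coefs K 4 d p] = 0.
Proof.
move=> pd pC; rewrite -/(ev _ _) rmorphM /= -!/(ev _ _).
have d0 : (0 < d)%N by lia.
have [al|[c ac bc]] := cartesian_common_root pd d0 pC.
  by rewrite -(coef_map (ev p)) ev_alpha al mulr0.
have sza : (1 < size (alpha gen))%N by rewrite size_alpha_gen; lia.
have szb : (1 < size (beta gen))%N by rewrite size_beta_gen; nia.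
(* At an arbitrary [p] the leading coefficients may vanish, so the resultant is not specialised
   directly. It is written as a combination of [alpha gen] and [beta gen], an identity that survives
   evaluation at [p] and then at the common root [c]. *)
have [[u v] _ /= res] := resultant_in_ideal sza szb.
suff -> : ev p (resultant (alpha gen) (beta gen)) = 0 by rewrite mul0r.
have := congr1 (fun q => (map_poly (ev p) q).[c]) res.
rewrite /= map_polyC hornerC rmorphD !rmorphM /= ev_alpha ev_beta.
by rewrite hornerD !hornerM ac bc !mulr0 addr0.
Qed.

End Resultant.

(* R[i] is the field of complex numbers, R being the real numbers. *)
Theorem theorem1p4 (R : realType) (d : nat) (hd : (2 <= d)%N) :
  zariski_generic d (fun F : {mpoly R[i][4]} => ~ Cartesian F).
Proof.
pose Z (p : {mpoly R[i][4]}) :=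
  deg_le d p /\ (discr R[i] d).@[@coefs R[i] 4 d p] = 0.
exists (fun p => deg_le d p /\ ~ Z p); split.
- exists Z => //; exists (fun Q => Q = discr R[i] d) => p; split=> [[pd pQ]|[pd pQ]].
    by split=> // Q ->.
  by split=> //; apply: pQ.
- exists (witness d R[i]); split; first exact: witness_deg.
  by case=> _ /eqP; apply/negP/discr_witness.
- move=> p [pd pZ] pC; apply: pZ; split=> //.
  exact: discr_cartesian.
Qed.
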